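(* Let $d\ge 1$, let $\mathbf P\in\mathbb R^{d\times d}$ be an orthogonal matrix, and let $\pi:\{1,2,\ldots,d\}\to\{1,2,\ldots,d\}$ be a permutation. For $k\in\mathbb Z$ define $$\mathbf W_k=\mathbf P^{\mathsf T}\mathbf\Lambda^{(k)}\mathbf P,\qquad \mathbf\Lambda^{(k)}=(\mathbf I_d)_{\pi^k}.$$ Then $\mathbf W_{t-s}=\mathbf W_s^{\mathsf H}\mathbf W_t$ for all $s,t\in\mathbb Z$.
   Context: $\mathsf H$ denotes conjugate transposition, which for real matrices is the transpose $\mathsf T$; $\mathbf I_d$ is the $d\times d$ identity matrix. A permutation is a bijection of $\{1,\ldots,d\}$ onto itself, and $\pi^k$ is its $k$-th iterate under composition ($\pi^0$ is the identity and negative powers are iterates of the inverse). For a matrix $\mathbf M\in\mathbb R^{d\times d}$ with rows $\mathbf m_1^{\mathsf T},\ldots,\mathbf m_d^{\mathsf T}$ and a permutation $\sigma$ of $\{1,\ldots,d\}$, $\mathbf M_\sigma$ denotes the matrix whose $j$-th row is $\mathbf m_{\sigma(j)}^{\mathsf T}$. *)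

(* Defs.v *)
From HB Require Import structures.
From mathcomp Require Import all_boot all_order all_algebra all_fingroup.
From mathcomp Require Import reals.
Set Implicit Arguments.
Unset Strict Implicit.
Unset Printing Implicit Defensive.
Import GRing.Theory.
Local Open Scope ring_scope.

Definition orthogonal_mx (R : realType) (d : nat) (P : 'M[R]_d) : Prop :=
  P^T *m P = 1%:M.

(* [Negz n] encodes [- n.+1]; powers in the group ['S_d] are iterates under
   composition, see [permX]. *)
Definition perm_zpow (d : nat) (s : 'S_d) (k : int) : 'S_d :=
  match k with
  | Posz n => (s ^+ n)%g
  | Negz n => (s ^- n.+1)%g
  end.

(* [row_perm s M] has row [s j] of [M] as its [j]-th row. *)
Definition Lambda_mx (R : realType) (d : nat) (s : 'S_d) (k : int) : 'M[R]_d :=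
  row_perm (perm_zpow s k) 1%:M.

Definition W_mx (R : realType) (d : nat) (P : 'M[R]_d) (s : 'S_d) (k : int) :
    'M[R]_d :=
  P^T *m Lambda_mx R s k *m P.

(* Main.v *)
Require Import Defs.
From HB Require Import structures.
From mathcomp Require Import all_boot all_order all_algebra all_fingroup.
From mathcomp Require Import reals.
Import GRing.Theory.
Local Open Scope ring_scope.

(** Integer powers of a permutation add exponents ([perm_zpowD]), and permutation matrices turn
    products into products and inverses into transposes. Hence $\Lambda^{(t-s)} = (\Lambda^{(s)})^T
    \Lambda^{(t)}$; in $W_s^T W_t$ the inner factor $P P^T$ is the identity, so conjugation by $P$
    preserves this relation. *)

Lemma perm_zpowS (d : nat) (p : 'S_d) (k : int) :
  perm_zpow p (k + 1) = (p * perm_zpow p k)%g.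
Proof.
(* The exponent $-1$ is separate because its successor crosses from [Negz] to [Posz]. *)
case: k => [n | [|n]].
- by rewrite -PoszD addn1 /= expgS.
- by rewrite /= expg1 mulgV.
- rewrite (_ : Negz n.+1 + 1 = Negz n); last by rewrite !NegzE -addn1 PoszD opprD addrNK.
  by rewrite /= [(p ^+ n.+2)%g]expgSr invMg mulKVg.
Qed.

Lemma perm_zpowD (d : nat) (p : 'S_d) (k l : int) :
  perm_zpow p (k + l) = (perm_zpow p k * perm_zpow p l)%g.
Proof.
elim/int_ind: k => [|n IHn|n IHn]; first by rewrite add0r mul1g.
- by rewrite -addn1 PoszD addrAC !perm_zpowS IHn mulgA.
(* Descending induction: multiplying by [p] raises the exponents on both sides by one, back to the
   hypothesis at $-n$. *)
- apply: (mulgI p); rewrite mulgA -!perm_zpowS addrAC.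
  by rewrite -addn1 PoszD opprD addrNK.
Qed.

(** The inverse is put on the left to match the order of the factors $W_s^T W_t$. *)
Lemma perm_zpowB (d : nat) (p : 'S_d) (k l : int) :
  perm_zpow p (k - l) = ((perm_zpow p l)^-1 * perm_zpow p k)%g.
Proof. by apply: (mulgI (perm_zpow p l)); rewrite -perm_zpowD mulKVg addrC subrK. Qed.

Theorem proposition3p5 (R : realType) (d : nat) (hd : (1 <= d)%N)
    (P : 'M[R]_d) (hP : orthogonal_mx P) (pi : 'S_d) (s t : int) :
  W_mx P pi (t - s) = (W_mx P pi s)^T *m W_mx P pi t.
Proof.
(* A one-sided inverse of a square matrix is two-sided. *)
have PPT : P *m P^T = 1%:M by exact: mulmx1C.
have LambdaE k : Lambda_mx R pi k = perm_mx (perm_zpow pi k) by [].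
rewrite /W_mx !LambdaE perm_zpowB perm_mxM -tr_perm_mx !trmx_mul trmxK.
by rewrite !mulmxA -[_ *m P *m P^T]mulmxA PPT mulmx1.
Qed.
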